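(* Let $d\in\{2,3\}$, $\tau>0$, and let $D\subset\mathbb{R}^d$ be a symmetric dimer. Suppose that $\omega\in\mathbb{C}$ is a nonlinear dielectric resonance of $u=\tau\omega^2\mathcal{K}_D^\omega[u+|u|^2u]$ with a resonant state $u\in H^2(D)$, $u\not\equiv0$, which is unique up to a phase factor $e^{i\theta}$, $\theta\in[0,2\pi)$. Then $u$ is either symmetric (even, $\mathcal{R}[u]=u$) or antisymmetric (odd, $\mathcal{R}[u]=-u$).
   Context: $\mathcal{R}[\varphi](x_1,x_2,\dots)=\varphi(-x_1,x_2,\dots)$ is the reflection in $\{x_1=0\}$. Symmetric dimer: $D=D_1\cup D_2$, $D_1=D_0-Le_1$, $D_2=\mathcal{R}(D_0)+Le_1$, with $e_1$ the first unit vector, $D_0$ a bounded connected open set with smooth boundary centered at the origin, $\mathcal{R}(D_0)$ its reflection, and $L>0$ such that $D_1,D_2$ are disjoint. $\mathcal{K}_D^\omega[\varphi](x)=\int_DG^\omega(x-y)\varphi(y)\,dy$ with $G^\omega(x)=\frac{e^{i\omega|x|}}{4\pi|x|}$ for $d=3$ and $G^\omega(x)=\frac i4H_0^{(1)}(\omega|x|)$ for $d=2$. A nonlinear dielectric resonance is an $\omega$ for which the stated equation has a nontrivial solution $u\in H^2(D)$, called a resonant state. *)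

(* Defs.v *)
From HB Require Import structures.
From mathcomp Require Import all_boot all_order all_algebra.
From mathcomp Require Import complex.
From mathcomp Require Import all_classical all_reals all_analysis.

Set Implicit Arguments.
Unset Strict Implicit.
Unset Printing Implicit Defensive.

Import Order.TTheory GRing.Theory Num.Theory.
Import numFieldNormedType.Exports.

Local Open Scope classical_set_scope.
Local Open Scope complex_scope.
Local Open Scope ring_scope.

Section measurable_rV.
Context {R : realType} (d : nat).

Let coor (i : 'I_d) (x : 'rV[R]_d) : measurableTypeR R := x ord0 i.

Let rV_set0 : g_sigma_preimage coor set0.
Proof. exact: sigma_algebra0. Qed.

Let rV_setC A : g_sigma_preimage coor A -> g_sigma_preimage coor (~` A).
Proof. exact: sigma_algebraC. Qed.

Let rV_bigcup (F : (set 'rV[R]_d)^nat) :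
  (forall i, g_sigma_preimage coor (F i)) ->
  g_sigma_preimage coor (\bigcup_i F i).
Proof. exact: sigma_algebra_bigcup. Qed.

(* As for [n.-tuple T], the sigma-algebra generated by the coordinates; on R^d
   it is the Borel sigma-algebra. *)
HB.instance Definition _ :=
  @isMeasurable.Build (measure_tuple_display default_measure_display) 'rV[R]_d
    (g_sigma_preimage coor) rV_set0 rV_setC rV_bigcup.

Lemma measurable_coor (i : 'I_d) : measurable_fun [set: 'rV[R]_d] (coor i).
Proof.
move=> _ Y mY; rewrite setTI; apply: sub_sigma_algebra => /=.
rewrite -bigcup_seq/=; exists i => /=; first by rewrite mem_index_enum.
by exists Y => //; rewrite setTI.
Qed.

Lemma measurable_fun_rVP d' (T : measurableType d') (f : T -> 'rV[R]_d) :
  (forall i, measurable_fun [set: T] (coor i \o f)) ->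
  measurable_fun [set: T] f.
Proof.
move=> mf _ A mA; rewrite setTI.
suff: (g_sigma_preimage (fun i => coor i \o f)) `<=` measurable.
  by apply; rewrite g_sigma_preimage_comp; exists A => //; rewrite setTI.
apply: smallest_sub; first exact: sigma_algebra_measurable.
case: d coor f mf {A mA} => [|n] c f mf; first by rewrite big_ord0.
rewrite -bigcup_mkord_ord; apply: bigcup_sub => i Ii.
by move=> A [B mB <-]; exact: mf.
Qed.

End measurable_rV.

Section lebesgue_rV.
Context {R : realType}.

Definition cons_rV {d} (p : measurableTypeR R * 'rV[R]_d) : 'rV[R]_d.+1 :=
  \row_i oapp (p.2 ord0) p.1 (unlift ord0 i).

Lemma measurable_cons_rV d :
  measurable_fun [set: measurableTypeR R * 'rV[R]_d] (@cons_rV d).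
Proof.
apply: measurable_fun_rVP => i.
case: (unliftP ord0 i) => [j ->|->].
  rewrite (_ : _ \o _ =
    (fun x : 'rV[R]_d => x ord0 j : measurableTypeR R) \o snd).
    by apply: measurableT_comp; [exact: measurable_coor|].
  by apply/funext => p /=; rewrite mxE liftK.
rewrite (_ : _ \o _ = fst)//.
by apply/funext => p /=; rewrite mxE unlift_none.
Qed.

Fixpoint lebesgue_rV (d : nat) : set 'rV[R]_d -> \bar R :=
  match d with
  | 0 => \d_(0 : 'rV[R]_0)
  | d'.+1 => pushforward (lebesgue_measure \x @lebesgue_rV d')%E cons_rV
  end.
Arguments lebesgue_rV : clear implicits.

Lemma lebesgue_rV_sigma_finite_measure d :
  exists m : {sigma_finite_measure set 'rV[R]_d -> \bar R}, lebesgue_rV d = m.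
Proof.
elim: d => [|d [m mE]]; first by exists (\d_(0 : 'rV[R]_0)).
have mc := @measurable_cons_rV d.
pose p : {measure set _ -> \bar R} := (lebesgue_measure \x m)%E.
pose uncons (x : 'rV[R]_d.+1) : measurableTypeR R * 'rV[R]_d :=
  (x ord0 ord0, \row_i x ord0 (lift ord0 i)).
have unconsK : cancel cons_rV uncons.
  move=> [a v]; rewrite /uncons; congr pair; first by rewrite mxE unlift_none.
  by apply/rowP => i; rewrite !mxE liftK.
have mu : measurable_fun setT uncons.
  apply/measurable_fun_pairP; split; first exact: measurable_coor.
  apply: measurable_fun_rVP => i.
  rewrite (_ : _ \o _ =
    (fun x : 'rV[R]_d.+1 => x ord0 (lift ord0 i) : measurableTypeR R)).
    exact: measurable_coor.
  by apply/funext => x /=; rewrite mxE.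
have [q qE] : exists q : {measure set 'rV[R]_d.+1 -> \bar R},
    pushforward p cons_rV = q.
  by unshelve eexists (pushforward p cons_rV); [exact: mc|].
have sq : sigma_finite [set: 'rV[R]_d.+1] q.
  have /sigma_finiteP[F [FT ndF Foo]] := sigma_finiteT (@lebesgue_measure R).
  have /sigma_finiteP[G [GT ndG Goo]] := sigma_finiteT m.
  exists (fun n => uncons @^-1` (F n `*` G n)).
    apply/esym; rewrite -preimage_bigcup -subTset => x _.
    have: setT (uncons x).1 by []. rewrite FT => -[a _ Fa].
    have: setT (uncons x).2 by []. rewrite GT => -[b _ Gb].
    exists (maxn a b) => //; split.
    - exact: (subsetPset _ _ (ndF _ _ (leq_maxl a b))).
    - exact: (subsetPset _ _ (ndG _ _ (leq_maxr a b))).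
  move=> k; have [mF Fk] := Foo k; have [mG Gk] := Goo k; split.
    by rewrite -[X in measurable X]setTI; apply: mu => //; exact: measurableX.
  rewrite -qE /pushforward (_ : _ @^-1` _ = F k `*` G k).
    by rewrite /p/= product_measure1E// lte_mul_pinfty// ge0_fin_numE.
  apply/funext => x.
  exact: (congr1 (F k `*` G k) (unconsK x)).
pose s1 := isSFinite.Build _ _ _ _ (sfinite_measure_sigma_finite sq).
pose s2 := isSigmaFinite.Build _ _ _ _ sq.
pose q' := HB.pack_for {sigma_finite_measure set 'rV[R]_d.+1 -> \bar R}
  (Measure.sort q) s1 s2.
by exists q'; rewrite /= mE qE.
Qed.

Section lebesgue_rV_instances.
Variable d : nat.

Let lebesgue_rV0 : lebesgue_rV d set0 = 0%E.
Proof. by have [m ->] := lebesgue_rV_sigma_finite_measure d; exact: measure0. Qed.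

Let lebesgue_rV_ge0 A : (0 <= lebesgue_rV d A)%E.
Proof.
by have [m ->] := lebesgue_rV_sigma_finite_measure d; exact: measure_ge0.
Qed.

Let lebesgue_rV_semi_sigma_additive : semi_sigma_additive (lebesgue_rV d).
Proof.
have [m ->] := lebesgue_rV_sigma_finite_measure d.
exact: measure_semi_sigma_additive.
Qed.

HB.instance Definition _ := isMeasure.Build _ _ _ (lebesgue_rV d)
  lebesgue_rV0 lebesgue_rV_ge0 lebesgue_rV_semi_sigma_additive.

Let lebesgue_rV_sigma_finite : sigma_finite setT (lebesgue_rV d).
Proof.
by have [m ->] := lebesgue_rV_sigma_finite_measure d; exact: sigma_finiteT.
Qed.

HB.instance Definition _ := Measure_isSigmaFinite.Build _ _ _ (lebesgue_rV d)
  lebesgue_rV_sigma_finite.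

End lebesgue_rV_instances.

End lebesgue_rV.
Arguments lebesgue_rV {R} d _.

Section complex_functions.
Context {R : realType}.
Implicit Types z w : R[i].

Definition iC : R[i] := 0 +i* 1.

Definition cexp z : R[i] :=
  (expR (complex.Re z))%:C * (cos (complex.Im z) +i* sin (complex.Im z)).

(* principal argument, in ]-pi, pi], of a nonzero complex number *)
Definition carg z : R :=
  let a := acos (complex.Re z / Normc.normc z) in if 0 <= complex.Im z then a else - a.

Definition clog z : R[i] := ln (Normc.normc z) +i* carg z.

Definition csum (f : nat -> R[i]) : R[i] := limn (series (f : nat -> (R[i])^o)).

Definition euler_gamma : R :=
  limn (fun n : nat => series harmonic n - ln n%:R : R).

Definition besselJ0 z : R[i] :=
  csum (fun k => (-1) ^+ k * (z ^+ 2 / 4) ^+ k / (k`!%:R) ^+ 2).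

(* [series harmonic k] is the k-th harmonic number 1 + 1/2 + ... + 1/k, so the
   term k = 0 vanishes. *)
Definition besselY0 z : R[i] :=
  (2 / pi)%:C * (clog (z / 2) + euler_gamma%:C) * besselJ0 z +
  (2 / pi)%:C * csum (fun k =>
    (-1) ^+ k.+1 * (series harmonic k : R)%:C *
    (z ^+ 2 / 4) ^+ k / (k`!%:R) ^+ 2).

(* Principal branch of the Hankel function H_0^(1), cut along ]-oo, 0] *)
Definition hankel10 z : R[i] := besselJ0 z + iC * besselY0 z.

End complex_functions.

Section euclidean_space.
Context {R : realType} {d : nat}.
Local Notation pt := 'rV[R]_d.
Local Notation mu := (@lebesgue_rV R d).

(* The library's norm on [pt] is the max norm; it gives the same topology and
   bounded sets. *)
Definition enorm (x : pt) : R := Num.sqrt (\sum_i x ord0 i ^+ 2).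

(* The coordinate x_1 has index 0. *)
Definition unit1 : pt := \row_i (val i == 0%N)%:R.

(* Reflection of points in the hyperplane {x_1 = 0}; [reflection] is the induced
   operator on functions. *)
Definition mirror (x : pt) : pt :=
  \row_i (if val i == 0%N then - x ord0 i else x ord0 i).

Definition reflection (u : pt -> R[i]) : pt -> R[i] := u \o mirror.

Definition cintegral (D : set pt) (f : pt -> R[i]) : R[i] :=
  (\int[mu]_(x in D) complex.Re (f x)) +i* (\int[mu]_(x in D) complex.Im (f x)).

Definition ae_in (D : set pt) (P : pt -> Prop) : Prop :=
  {ae mu, forall x, D x -> P x}.

Definition partial (i : 'I_d) (f : pt -> R) (x : pt) : R :=
  'D_(delta_mx ord0 i) f x.

Fixpoint Ck (k : nat) (f : pt -> R) : Prop :=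
  match k with
  | 0 => continuous f
  | k'.+1 => continuous f /\
      forall i, (forall x, derivable f x (delta_mx ord0 i)) /\
                Ck k' (partial i f)
  end.

Definition smooth (f : pt -> R) : Prop := forall k, Ck k f.

(* Near each boundary point, D is the sublevel set of a smooth function with
   nonvanishing gradient. *)
Definition smooth_boundary (D : set pt) : Prop :=
  forall p, closure D p -> ~ interior D p ->
  exists (U : set pt) (rho : pt -> R),
    [/\ open_nbhs p U, smooth rho, exists i, partial i rho p != 0 &
        D `&` U = [set x | rho x < 0] `&` U].

(* The barycenter of D is the origin. *)
Definition centered (D : set pt) : Prop :=
  forall i, \int[mu]_(x in D) (x ord0 i) = 0.

Definition symmetric_dimer (D : set pt) : Prop :=
  exists (D0 : set pt) (L : R),
  let D1 := [set x - L *: unit1 | x in D0] in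
  let D2 := [set x + L *: unit1 | x in mirror @` D0] in
  [/\ [/\ bounded_set D0, connected D0, open D0, smooth_boundary D0 &
           centered D0],
      0 < L, D1 `&` D2 = set0 & D = D1 `|` D2].

(* H^k(D), with derivatives in the sense of distributions *)

Definition square_integrable (D : set pt) (u : pt -> R[i]) : Prop :=
  [/\ measurable_fun D (fun x => complex.Re (u x)),
      measurable_fun D (fun x => complex.Im (u x)) &
      mu.-integrable D (fun x => (Normc.normc (u x) ^+ 2)%:E)].

Definition test_function (D : set pt) (phi : pt -> R) : Prop :=
  smooth phi /\
  exists K : set pt, [/\ compact K, K `<=` D & forall x, ~ K x -> phi x = 0].

Definition weak_partial (D : set pt) (i : 'I_d) (u g : pt -> R[i]) : Prop :=
  forall phi, test_function D phi ->
  cintegral D (fun x => u x * (partial i phi x)%:C) =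
  - cintegral D (fun x => g x * (phi x)%:C).

Fixpoint sobolev (k : nat) (D : set pt) (u : pt -> R[i]) : Prop :=
  match k with
  | 0 => square_integrable D u
  | k'.+1 => square_integrable D u /\
      forall i, exists g, weak_partial D i u g /\ sobolev k' D g
  end.

(* Outgoing fundamental solution of the Helmholtz operator; only d = 2, 3 are
   meaningful. *)
Definition green (omega : R[i]) (x : pt) : R[i] :=
  match d with
  | 2 => iC / 4 * hankel10 (omega * (enorm x)%:C)
  | 3 => cexp (iC * omega * (enorm x)%:C) / (4 * pi * enorm x)%:C
  | _ => 0
  end.

(* For phi = u + |u|^2 u with u in H^2(D), the integrand is integrable because
   H^2(D) embeds into L^oo(D) when d <= 3. *)
Definition KD (D : set pt) (omega : R[i]) (phi : pt -> R[i]) (x : pt) : R[i] :=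
  cintegral D (fun y => green omega (x - y) * phi y).

(* u is a resonant state at the frequency omega; elements of H^2(D) are
   identified when they agree almost everywhere in D. *)
Definition resonant_state (tau : R) (D : set pt) (omega : R[i])
    (u : pt -> R[i]) : Prop :=
  [/\ sobolev 2 D u,
      ~ ae_in D (fun x => u x = 0) &
      ae_in D (fun x => u x =
        tau%:C * omega ^+ 2 * KD D omega (fun y => u y + `|u y| ^+ 2 * u y) x)].

End euclidean_space.

(* Main.v *)
(* The reflection maps D to itself, preserves Lebesgue measure and |x - y|, so
   it commutes with K_D^omega and R[u] is again a resonant state. By uniqueness
   R[u] = c u with c = e^(i theta); applying R twice gives u = c^2 u, hence
   c^2 = 1 because u does not vanish, i.e. c = 1 or c = -1. *)

Require Import Defs.
From mathcomp Require Import all_boot all_order all_algebra.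
From mathcomp Require Import complex.
From mathcomp Require Import all_classical all_reals all_analysis.
From mathcomp Require Import measurable_realfun.
From HB Require Import structures.

Set Implicit Arguments.
Unset Strict Implicit.
Unset Printing Implicit Defensive.

Import Order.TTheory GRing.Theory Num.Theory.
Import numFieldNormedType.Exports.

Local Open Scope classical_set_scope.
Local Open Scope complex_scope.
Local Open Scope ring_scope.

(** * Change of variables under a measure-preserving involution *)

Section measure_preserving_involution.
Local Open Scope ereal_scope.
Context {dT} {T : measurableType dT} {R : realType}.
Variables (mu : {measure set T -> \bar R}) (s : T -> T).
Hypotheses (ms : measurable_fun [set: T] s) (sK : involutive s).
Hypothesis mus : forall A, measurable A -> mu (s @^-1` A) = mu A.

Let sKf (U : Type) (f : T -> U) : (f \o s) \o s = f.
Proof. by apply/funext => x /=; rewrite sK. Qed.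

Lemma measurable_preimage_involution A :
  measurable (s @^-1` A) <-> measurable A.
Proof.
have mp B : measurable B -> measurable (s @^-1` B).
  by move=> mB; rewrite -[X in measurable X]setTI; exact: ms.
split=> [/mp|/mp//].
by rewrite -comp_preimage (_ : s \o s = id)//; exact/funext.
Qed.

(** [measurable_fun] takes measurability of its domain as a premise; the equivalence above carries
    it from the preimage back to [D]. *)
Lemma measurable_fun_comp_involution d' (U : sigmaRingType d') (D : set T)
    (f : T -> U) :
  measurable_fun D f -> measurable_fun (s @^-1` D) (f \o s).
Proof.
move=> mf /measurable_preimage_involution mD Y mY.
by apply/(measurable_preimage_involution (D `&` f @^-1` Y)); exact: mf.
Qed.

Import HBNNSimple.

(** Each level set of [h \o s] is the preimage of a level set of [h], of equal measure, so the sums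
    agree term by term. *)
Let nnsfun_comp (h : {nnsfun T >-> R}) :
  exists2 g : {nnsfun T >-> R}, g = h \o s :> (T -> R) &
    sintegral mu g = sintegral mu h.
Proof.
have mh : measurable_fun [set: T] (h \o s) by exact: measurableT_comp.
pose p0 := isMeasurableFun.Build _ _ _ _ (h \o s) mh.
have fh : finite_set (range (h \o s)).
  by apply: (sub_finite_set _ (fimfunP h)) => _ [x _ <-]; exists (s x).
pose p1 := FiniteImage.Build _ _ (h \o s) fh.
have nh x : (0 <= (h \o s) x)%R by exact: fun_ge0.
pose p2 := isNonNegFun.Build _ _ (h \o s) nh.
pose g := HB.pack_for {nnsfun T >-> R} (h \o s) p0 p1 p2.
exists g => //; rewrite /sintegral; apply: eq_fsbigr => x _.
by rewrite [g @^-1` _]comp_preimage mus.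
Qed.

Let nnint (f : T -> \bar R) := ereal_sup [set sintegral mu h |
  h in [set h : {nnsfun T >-> R} | forall x, (h x)%:E <= f x]].

Let nnint_comp f : nnint (f \o s) = nnint f.
Proof.
(* One inequality suffices: taken at [f \o s] it gives the other, since [s] is involutive. *)
suff le g : nnint g <= nnint (g \o s).
  by apply/eqP; rewrite eq_le le andbT -{2}[f]sKf le.
apply: ge_ereal_sup => _ [h hg <-]; have [k kE <-] := nnsfun_comp h.
by apply: ereal_sup_ubound; exists k => //= x; rewrite kE; exact: hg.
Qed.

(* Substituting the involution in the simple functions below the integrand
   leaves no measurability requirement on D or f. *)
Lemma integral_comp_involution (D : set T) (f : T -> \bar R) :
  \int[mu]_(x in s @^-1` D) f (s x) = \int[mu]_(x in D) f x.
Proof.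
rewrite /integral (_ : (fun x => f (s x)) \_ (s @^-1` D) = (f \_ D) \o s).
  rewrite funepos_comp funeneg_comp.
  have := nnint_comp (f \_ D)^\+; have := nnint_comp (f \_ D)^\-.
  by rewrite /nnint => -> ->.
by apply/funext => x; rewrite /= !patchE.
Qed.

Lemma Rintegral_comp_involution (D : set T) (f : T -> R) :
  (\int[mu]_(x in s @^-1` D) f (s x) = \int[mu]_(x in D) f x)%R.
Proof. by congr fine; exact: (integral_comp_involution D (EFin \o f)). Qed.

Lemma integrable_comp_involution (D : set T) (f : T -> \bar R) :
  mu.-integrable D f -> mu.-integrable (s @^-1` D) (f \o s).
Proof.
move=> /integrableP[mf foo]; apply/integrableP; split.
  exact: measurable_fun_comp_involution.
by rewrite (integral_comp_involution D (fun x => `|f x|)).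
Qed.

Lemma ae_comp_involution (P : T -> Prop) :
  {ae mu, forall x, P x} -> {ae mu, forall x, P (s x)}.
Proof.
move=> [N [mN N0 PN]]; exists (s @^-1` N); split.
- exact/measurable_preimage_involution.
- by rewrite mus.
- by move=> x nP; exact: PN.
Qed.

End measure_preserving_involution.

(* Holds for every f: when one of the two parts has infinite integral, the
   junk values fine +oo = fine -oo = 0 agree with the opposite. *)
Lemma RintegralN_arbitrary dT (T : measurableType dT) (R : realType)
    (mu : {measure set T -> \bar R}) (D : set T) (f : T -> R) :
  \int[mu]_(x in D) - f x = - \int[mu]_(x in D) f x.
Proof.
rewrite /Rintegral (_ : (fun x => (- f x)%:E) = (\- (EFin \o f))%E)//.
rewrite integralE [in RHS]integralE funeposN funenegN.
by do 2 case: (integral _ _ _) => [?||] /=; rewrite ?oppr0// opprB.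
Qed.

(** * The mirror and the invariance of Lebesgue measure *)

Section mirror.
Context {R : realType} {d : nat}.
Local Notation pt := 'rV[R]_d.

Lemma mirrorK : involutive (@mirror R d).
Proof.
by move=> x; apply/rowP => i; rewrite !mxE /=; case: (_ == 0%N); rewrite ?opprK.
Qed.

Lemma mirrorD (x y : pt) : mirror (x + y) = mirror x + mirror y.
Proof.
by apply/rowP => i; rewrite !mxE /=; case: (_ == 0%N); rewrite ?opprD.
Qed.

Lemma mirrorZ (a : R) (x : pt) : mirror (a *: x) = a *: mirror x.
Proof.
by apply/rowP => i; rewrite !mxE /=; case: (_ == 0%N); rewrite ?mulrN.
Qed.

Lemma mirrorN (x : pt) : mirror (- x) = - mirror x.
Proof. by rewrite -scaleN1r mirrorZ scaleN1r. Qed.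

Lemma mirror_unit1 : mirror (unit1 : pt) = - unit1.
Proof.
by apply/rowP => i; rewrite !mxE /=; case: (_ == 0%N); rewrite ?oppr0.
Qed.

(** Coordinate vectors are eigenvectors for -1 or 1, so partial derivatives of mirrored functions
    are mirrored partial derivatives up to sign. *)
Lemma mirror_delta (i : 'I_d) :
  mirror (delta_mx ord0 i : pt) =
  if val i == 0%N then - delta_mx ord0 i else delta_mx ord0 i.
Proof.
apply/rowP => j; rewrite !mxE eqxx /=.
have [->|ji] := eqVneq j i; first by case: (_ == 0%N); rewrite !mxE !eqxx.
by rewrite oppr0 if_same; case: (_ == 0%N); rewrite !mxE (negbTE ji) ?oppr0.
Qed.

Lemma enorm_mirror (x : pt) : enorm (mirror x) = enorm x.
Proof.
congr Num.sqrt; apply: eq_bigr => i _; rewrite mxE.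
by case: ifP => // _; rewrite sqrrN.
Qed.

Lemma continuous_mirror : continuous (@mirror R d).
Proof.
move=> x A /nbhs_ballP[e e0 eA]; apply/nbhs_ballP; exists e => // y [_ xy].
apply: eA; split=> // i j; have := xy i j; rewrite !mxE (ord1 i).
by case: ifP => // _; rewrite /ball /= -opprD normrN.
Qed.

Lemma measurable_mirror : measurable_fun [set: pt] (@mirror R d).
Proof.
apply: measurable_fun_rVP => i.
have mc := @measurable_coor R d i.
rewrite (_ : _ \o _ = fun x : pt =>
  (if val i == 0%N then - x ord0 i else x ord0 i) : measurableTypeR R).
  by case: (val i == 0%N) => //; exact: measurable_funN.
by apply/funext => x /=; rewrite mxE.
Qed.

End mirror.

Lemma mirror_cons_rV (R : realType) (d : nat) (a : R) (v : 'rV[R]_d) :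
  mirror (cons_rV (a, v)) = cons_rV (- a, v).
Proof.
by apply/rowP => i; rewrite !mxE /=; case: unliftP => [j ->|->].
Qed.

(** The mirror acts only on the first factor of the product measure, where Lebesgue measure on the
    line is invariant under negation. *)
Lemma lebesgue_rV_mirror (R : realType) (d : nat) (A : set 'rV[R]_d) :
  measurable A -> lebesgue_rV d (mirror @^-1` A) = lebesgue_rV d A.
Proof.
case: d A => [|d] A mA.
  (* In dimension 0 the space is a single point. *)
  by congr (lebesgue_rV 0 _); apply/funext => x; congr A; apply/rowP; case.
rewrite /= /pushforward /product_measure1.
rewrite -[RHS](@integral_comp_involution _ (measurableTypeR R) R
  lebesgue_measure -%R).
(* Mirroring turns the section at [a] into the section at [- a]. *)
- rewrite preimage_setT; apply: eq_integral => a _ /=.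
  congr (lebesgue_rV d _); apply/seteqP; split=> v;
    by rewrite /xsection /= !inE /preimage /= mirror_cons_rV.
- exact: measurable_funN.
- exact: opprK.
- exact: lebesgue_measureN.
Qed.

(** * Derivatives and smoothness under the mirror *)

(** The quotient along [- v] at step [h] is minus the quotient along [v] at step [- h]. *)
Lemma is_derive_opp_dir (R : realType) (V W : normedModType R) (f : V -> W)
    (x v : V) (df : W) :
  is_derive x v f df -> is_derive x (- v) f (- df).
Proof.
move=> [dfx <-].
pose q h := h^-1 *: ((f \o shift x) (h *: v) - f x).
have oppc : -%R @ (0 : R)^' --> (0 : R)^'.
  rewrite -{2}oppr0 dnbhsN => A [B B0 <-].
  by apply: filterS B0 => y By; exists y.
have dc : (q \o -%R) @ (0 : R)^' --> 'D_v f x by exact: cvg_comp oppc dfx.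
have : (fun h => h^-1 *: ((f \o shift x) (h *: - v) - f x)) @ 0^'
    --> - 'D_v f x.
  rewrite (_ : (fun h => _) = - (q \o -%R)); first exact: cvgN.
  by apply/funext => h; rewrite /q !fctE/= scaleNr scalerN invrN scaleNr opprK.
by move=> lim; split; [exact: cvgP lim|exact: cvg_lim lim].
Qed.

Section mirror_derive.
Context {R : realType} {d : nat}.
Local Notation pt := 'rV[R]_d.
Implicit Types f : pt -> R.

(** The mirror is linear, so both difference quotients are the same function of [h]; only
    directional derivatives enter. *)
Lemma is_derive_comp_mirror f x v df :
  is_derive (mirror x) (mirror v) f df -> is_derive x v (f \o mirror) df.
Proof.
move=> [dfx <-].
have E : (fun h => h^-1 *:
    (((f \o mirror) \o shift x) (h *: v) - (f \o mirror) x))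
  = (fun h => h^-1 *: ((f \o shift (mirror x)) (h *: mirror v) - f (mirror x))).
  by apply/funext => h; rewrite /= mirrorD mirrorZ.
by split; rewrite /derivable /derive E.
Qed.

Lemma is_derive_mirror f (i : 'I_d) x :
  derivable f (mirror x) (delta_mx ord0 i) ->
  is_derive x (delta_mx ord0 i) (f \o mirror)
    (if val i == 0%N then - partial i f (mirror x) else partial i f (mirror x)).
Proof.
move=> /derivableP df; apply: is_derive_comp_mirror; rewrite mirror_delta.
by case: ifP => // _; exact: is_derive_opp_dir.
Qed.

Lemma CkN k f : Ck k f -> Ck k (fun x => - f x).
Proof.
elim: k f => [|k IHk] f /=.
  by move=> cf x; apply: continuousN; exact: cf.
move=> [cf Cf]; split; first by move=> x; apply: continuousN; exact: cf.
move=> i; have [df Cdf] := Cf i; split=> [x|].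
  exact: derivableN.
rewrite (_ : partial i _ = fun x => - partial i f x); first exact: IHk.
by apply/funext => x; rewrite /partial deriveN.
Qed.

Lemma partial_mirror f (i : 'I_d) :
  (forall x, derivable f x (delta_mx ord0 i)) ->
  partial i (f \o mirror) =
  if val i == 0%N then (fun x => - partial i f (mirror x))
  else partial i f \o mirror.
Proof.
move=> df; apply/funext => x.
rewrite /partial (@derive_val _ _ _ _ _ _ _ (is_derive_mirror (df _))).
by case: ifP.
Qed.

Lemma Ck_mirror k f : Ck k f -> Ck k (f \o mirror).
Proof.
elim: k f => [|k IHk] f /=.
  by move=> cf x; apply: continuous_comp; [exact: continuous_mirror|exact: cf].
move=> [cf Cf]; split.
  by move=> x; apply: continuous_comp; [exact: continuous_mirror|exact: cf].
move=> i; have [df Cdf] := Cf i; split=> [x|].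
  by have [] := is_derive_mirror (df (mirror x)).
rewrite partial_mirror//; case: ifP => _; last exact: IHk.
by apply: (@CkN _ (partial i f \o mirror)); exact: IHk.
Qed.

End mirror_derive.

(** * Sobolev functions and the integral operator on an invariant domain *)

Section mirror_invariant_domain.
Context {R : realType} {d : nat}.
Local Notation pt := 'rV[R]_d.
Variable D : set pt.
Hypothesis mirD : mirror @^-1` D = D.

Lemma cintegral_mirror (f : pt -> R[i]) :
  cintegral D (f \o mirror) = cintegral D f.
Proof.
rewrite /cintegral -{1 2}mirD; congr (_ +i* _);
  exact: (Rintegral_comp_involution measurable_mirror mirrorK
    (@lebesgue_rV_mirror R d) D (fun x => _ (f x))).
Qed.

(** Valid for every [f], so signs can be moved in weak derivatives without integrability checks. *)
Lemma cintegralN (f : pt -> R[i]) :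
  cintegral D (fun x => - f x) = - cintegral D f.
Proof.
rewrite /cintegral -[RHS]/((- _) +i* (- _)) -!RintegralN_arbitrary.
congr (_ +i* _); congr Rintegral; by apply/funext => x; case: (f x).
Qed.

Lemma ae_in_mirror (P : pt -> Prop) :
  ae_in D P -> ae_in D (fun x => P (mirror x)).
Proof.
move=> /(ae_comp_involution measurable_mirror mirrorK
  (@lebesgue_rV_mirror R d)).
rewrite /ae_in; apply: filterS => x /= PD Dx; apply: PD.
by rewrite -mirD in Dx.
Qed.

Lemma square_integrable_mirror u :
  square_integrable D u -> square_integrable D (u \o mirror).
Proof.
have mf := measurable_fun_comp_involution measurable_mirror mirrorK (D := D).
have intf := integrable_comp_involution measurable_mirror mirrorK
  (@lebesgue_rV_mirror R d) (D := D).
rewrite mirD in mf intf.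
by move=> [mre mim isq]; split; [exact: mf mre|exact: mf mim|exact: intf isq].
Qed.

Lemma square_integrableN u :
  square_integrable D u -> square_integrable D (fun x => - u x).
Proof.
move=> [mre mim isq]; split.
- rewrite (_ : (fun x => _) = \- (fun x => complex.Re (u x))).
    exact: measurable_funN.
  by apply/funext => x /=; case: (u x).
- rewrite (_ : (fun x => _) = \- (fun x => complex.Im (u x))).
    exact: measurable_funN.
  by apply/funext => x /=; case: (u x).
- rewrite (_ : (fun x => _) = fun x => (Normc.normc (u x) ^+ 2)%:E)//.
  by apply/funext => x; case: (u x) => a b; rewrite /= !sqrrN.
Qed.

Lemma test_function_mirror phi :
  test_function D phi -> test_function D (phi \o mirror).
Proof.
move=> [sphi [K [cK KD phi0]]]; split; first by move=> k; exact: Ck_mirror.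
exists (mirror @^-1` K); split.
(* For an involution preimage and image coincide, and a continuous image of a compact set is
   compact. *)
- rewrite (_ : _ @^-1` K = mirror @` K).
    apply: continuous_compact => //.
    exact/continuous_subspaceT/continuous_mirror.
  apply/seteqP; split=> [x Kx|_ [x Kx <-]]; last by rewrite /preimage/= mirrorK.
  by exists (mirror x) => //; exact: mirrorK.
- by rewrite -mirD; exact: preimage_subset.
- by move=> x; exact: phi0.
Qed.

Lemma weak_partialN i u g :
  weak_partial D i u g -> weak_partial D i (fun x => - u x) (fun x => - g x).
Proof.
move=> ug phi tphi; under [in LHS]eq_fun do rewrite mulNr.
under [in RHS]eq_fun do rewrite mulNr.
by rewrite !cintegralN ug.
Qed.

(** A change of variables moves the mirror onto the test function, and the mirrored test function is
    again admissible for [u]. *)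
Lemma weak_partial_mirror i u g :
  weak_partial D i u g ->
  weak_partial D i (u \o mirror)
    (if val i == 0%N then fun x => - g (mirror x) else g \o mirror).
Proof.
move=> ug phi tphi.
have dphi x : derivable phi x (delta_mx ord0 i).
  by have [_ /(_ i)[]] := tphi.1 1%N.
have E (h : pt -> R[i]) (k : pt -> R) :
    cintegral D (fun x => h (mirror x) * (k x)%:C) =
    cintegral D (fun x => h x * (k (mirror x))%:C).
  rewrite -cintegral_mirror; congr cintegral.
  by apply/funext => x /=; rewrite mirrorK.
rewrite [LHS]E; have := ug _ (test_function_mirror tphi).
rewrite partial_mirror// -[in X in - X](E g phi); case: ifP => _ //=.
(* In the first coordinate the sign from [partial_mirror] cancels the sign of integration by parts;
   the negated witness accounts for this. *)
under eq_fun do rewrite rmorphN mulrN.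
rewrite cintegralN /= => /eqP; rewrite eqr_opp => /eqP ->.
by under [in RHS]eq_fun do rewrite mulNr; rewrite cintegralN opprK.
Qed.

Lemma sobolevN k u : sobolev k D u -> sobolev k D (fun x => - u x).
Proof.
elim: k u => [|k IHk] u /=; first exact: square_integrableN.
move=> [su du]; split=> [|i]; first exact: square_integrableN.
have [g [ug sg]] := du i; exists (fun x => - g x).
by split; [exact: weak_partialN|exact: IHk].
Qed.

Lemma sobolev_mirror k u : sobolev k D u -> sobolev k D (u \o mirror).
Proof.
elim: k u => [|k IHk] u /=; first exact: square_integrable_mirror.
move=> [su du]; split=> [|i]; first exact: square_integrable_mirror.
have [g [ug sg]] := du i; eexists; split; first exact: weak_partial_mirror ug.
by case: (val i == 0%N); [apply: (@sobolevN _ (g \o mirror))|]; exact: IHk.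
Qed.

(** Substitute the mirrored [y]: the kernel depends only on [enorm], which the linear mirror
    preserves. *)
Lemma KD_mirror omega phi x :
  KD D omega (phi \o mirror) x = KD D omega phi (mirror x).
Proof.
rewrite /KD -cintegral_mirror; congr cintegral; apply/funext => y /=.
rewrite mirrorK; congr (_ * _).
suff -> : mirror x - y = mirror (x - mirror y) by rewrite /green enorm_mirror.
by rewrite mirrorD mirrorN mirrorK.
Qed.

Lemma resonant_state_mirror tau omega u :
  resonant_state tau D omega u -> resonant_state tau D omega (reflection u).
Proof.
move=> [su u0 eu]; split; first exact: sobolev_mirror.
(* If the reflection vanished almost everywhere, reflecting again would make [u] vanish. *)
- move=> /ae_in_mirror; apply: contra_not u0; rewrite /ae_in.
  by apply: filterS => x /=; rewrite /reflection/= mirrorK.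
- move: eu => /ae_in_mirror; rewrite /ae_in; apply: filterS => x /= eu Dx.
  (* The nonlinearity is pointwise, hence commutes with the mirror by conversion. *)
  by rewrite /reflection/= eu// -KD_mirror.
Qed.

End mirror_invariant_domain.

(** * Symmetry of the dimer and parity of the resonant state *)

(** The mirror reverses [unit1] and so swaps the two components; one inclusion suffices, by
    involutivity. *)
Lemma symmetric_dimer_mirror (R : realType) (d : nat) (D : set 'rV[R]_d) :
  symmetric_dimer D -> mirror @^-1` D = D.
Proof.
move=> [D0 [L [_ _ _ DE]]].
have mD x : D x -> D (mirror x).
  rewrite DE => -[[y Dy <-]|[_ [y Dy <-] <-]]; [right|left].
    exists (mirror y); first by exists y.
    by rewrite mirrorD mirrorN mirrorZ mirror_unit1 scalerN opprK.
  exists y => //.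
  by rewrite mirrorD mirrorK mirrorZ mirror_unit1 scalerN.
by apply/seteqP; split=> x /mD; rewrite ?mirrorK.
Qed.

Theorem lemma4p2 (R : realType) (d : nat) (hd : d = 2%N \/ d = 3%N)
    (tau : R) (htau : 0 < tau)
    (D : set 'rV[R]_d) (hD : symmetric_dimer D)
    (omega : R[i]) (u : 'rV[R]_d -> R[i])
    (hu : resonant_state tau D omega u)
    (huniq : forall v, resonant_state tau D omega v ->
      exists theta : R, 0 <= theta < 2 * pi /\
        ae_in D (fun x => v x = cexp (iC * theta%:C) * u x)) :
  ae_in D (fun x => reflection u x = u x) \/
  ae_in D (fun x => reflection u x = - u x).
Proof.
have mirD := symmetric_dimer_mirror hD.
have [theta [_]] := huniq _ (resonant_state_mirror mirD hu).
set c := cexp _ => ruE.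
(* Read at mirrored points, the relation says that [u] is [c] times its reflection. *)
have := ae_in_mirror mirD ruE; move: ruE; rewrite /ae_in => ruE ruE'.
have [c1|c2] := eqVneq (c ^+ 2) 1.
  move/eqP: c1; rewrite sqrf_eq1 => /orP[]/eqP c1; [left|right];
    by apply: filterS ruE => x /= + Dx => ->//; rewrite c1 ?mul1r ?mulN1r.
(* Otherwise [(1 - c ^+ 2) * u x = 0] almost everywhere in [D], which forces [u] to vanish there. *)
have [_ u0 _] := hu; exfalso; apply: u0.
apply: filterS2 ruE ruE' => x /= e1 e2 Dx.
have := e2 Dx; rewrite /reflection/= mirrorK.
have := e1 Dx; rewrite /reflection/= => -> /eqP.
rewrite mulrA -expr2 -subr_eq0 -{1}[u x]mul1r -mulrBl mulf_eq0 subr_eq0.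
by rewrite eq_sym (negbTE c2) => /eqP.
Qed.
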